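(* Let $G$ be a discrete group, $V$ a nonzero finite dimensional Hilbert space and $\ell:G\to\mathbb{B}_h(V)$ a proper translation bounded function. The spectral triple $(\mathbb{C}G,\ell^2(G)\otimes V,M_\ell)$ is finitely summable if and only if $G$ has polynomial growth with respect to $\ell$. In this case $\mathrm{abs}(\zeta_{M_\ell})$ coincides with the growth $d_G$ of $G$.
   Context: $\mathbb{B}_h(V)$ is the space of self-adjoint operators on $V$. A function $\ell:G\to\mathbb{B}_h(V)$ is translation bounded if for each $y\in G$ the function $x\mapsto\ell(x)-\ell(y^{-1}x)$ is bounded on $G$; it is proper if (i) $\ell(g)=0$ iff $g=e$ (the neutral element), (ii) $\mathcal{S}=\bigcup_{x\in G}\mathrm{Sp}\,\ell(x)$ is a discrete subset of $\mathbb{R}$, meaning it has finite intersection with every bounded interval, (iii) for each $t\in\mathcal{S}$ the set $\{x\in G:t\in\mathrm{Sp}\,\ell(x)\}$ is finite. The odd spectral triple $(\mathbb{C}G,\ell^2(G)\otimes V,M_\ell)$ on $C^*_r(G)$ has representation $\lambda(\delta_g)(\delta_x\otimes v)=\delta_{gx}\otimes v$ and Dirac operator the self-adjoint multiplication operator $M_\ell(\delta_x\otimes v)=\delta_x\otimes\ell(x)v$. For a spectral triple with Dirac operator $D$ put $\zeta_D(t)=\mathrm{tr}((I+D^2)^{-t/2})$. The triple is finitely summable if $\zeta_D(t)$ is finite for some $t$; then $\mathrm{abs}(\zeta_D)=\inf\{t>0:\zeta_D(t)<\infty\}$. Let $B_n=\{g\in G:\min\mathrm{Sp}(|\ell(g)|)\le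 n\}$ (a finite set). $G$ has polynomial growth w.r.t. $\ell$ if $\#B_n$ grows at most polynomially as $n\to\infty$; in this case the growth of $G$ is $d_G=\limsup_n\frac{\log(\#B_n)}{\log n}$. *)

(* Defs.v *)
From HB Require Import structures.
From mathcomp Require Import all_boot all_order all_algebra finmap.
From mathcomp Require Import all_classical all_reals all_analysis complex.
From mathcomp Require Import ring lra.

Set Implicit Arguments.
Unset Strict Implicit.
Unset Printing Implicit Defensive.

Import Order.TTheory GRing.Theory Num.Theory.
Local Open Scope classical_set_scope.
Local Open Scope ring_scope.
Local Open Scope complex_scope.

Local Notation conjC := Num.conj.

(* Inner products are linear in the first variable, conjugate-linear in the
   second (the convention of sesquilinear.v). *)
Definition norm_of (R : realType) (H : lmodType R[i])
  (dot : {dot H for conjC}) (u : H) : R := Num.sqrt (complex.Re (dot u u)).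

Section Sums.
Context (R : realType) (I : choiceType).
Implicit Types (f g : I -> R) (F K : I -> R[i]).

Definition rsum f : R :=
  fine (\esum_(i in [set: I]) (Num.max (f i) 0)%:E)
  - fine (\esum_(i in [set: I]) (Num.max (- f i) 0)%:E).

Definition csum F : R[i] :=
  rsum (fun i => complex.Re (F i)) +i* rsum (fun i => complex.Im (F i)).

Definition rsummable f := summable [set: I] (EFin \o f).

Definition csummable F :=
  rsummable (fun i => complex.Re (F i)) /\
  rsummable (fun i => complex.Im (F i)).

Lemma rsummable_le f g : (forall i, `|f i| <= g i) -> rsummable g ->
  rsummable f.
Proof.
move=> fg; apply: le_lt_trans; apply: le_esum => i _ /=.
by rewrite lee_fin (le_trans (fg i)) ?ler_norm.
Qed.

Lemma rsummableD f g : rsummable f -> rsummable g ->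
  rsummable (fun i => f i + g i).
Proof. exact: summableD. Qed.

Lemma esumZ (c : R) f : 0 <= c -> (forall i, 0 <= f i) ->
  (\esum_(i in [set: I]) (c * f i)%:E = c%:E * \esum_(i in [set: I]) (f i)%:E)%E.
Proof.
have le (a : R) (h : I -> R) : 0 <= a -> (forall i, 0 <= h i) ->
    (\esum_(i in [set: I]) (a * h i)%:E <=
       a%:E * \esum_(i in [set: I]) (h i)%:E)%E.
  move=> a0 h0; apply: ge_ereal_sup => _ [A [fA _] <-].
  rewrite (_ : (\sum_(x \in A) (a * h x)%:E = a%:E * \sum_(x \in A) (h x)%:E)%E).
    by apply: lee_wpmul2l; rewrite ?lee_fin//; apply: ereal_sup_ubound; exists A.
  by rewrite ge0_mule_fsumr// => i; rewrite lee_fin.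
move=> c0 f0; apply/eqP; rewrite eq_le le//=.
have [->|cn0] := eqVneq c 0.
  by rewrite mul0e; apply: esum_ge0 => i _; rewrite mul0r.
have cgt : 0 < c by rewrite lt_neqAle eq_sym cn0.
have := le c^-1 (fun i => c * f i); rewrite invr_ge0 => /(_ c0).
have -> : (fun i => (c^-1 * (c * f i))%:E) = (fun i => (f i)%:E).
  by apply/funext => i; rewrite mulrA mulVf ?mul1r.
move=> /(_ (fun i => mulr_ge0 c0 (f0 i))) h.
have := lee_wpmul2l (x := c%:E) _ h; rewrite lee_fin => /(_ c0).
by rewrite muleA -EFinM mulfV// mul1e.
Qed.

Lemma rsummableZ (c : R) f : rsummable f -> rsummable (fun i => c * f i).
Proof.
move=> sf; rewrite /rsummable /summable.
rewrite (_ : (fun x => _) = (fun x => (`|c| * `|f x|)%:E)); last first.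
  by apply/funext => i; rewrite /= normrM.
rewrite esumZ//; apply: lte_mul_pinfty; rewrite ?lee_fin//.
Qed.

Lemma fin_num_esum f : rsummable f -> (forall i, 0 <= f i) ->
  (\esum_(i in [set: I]) (f i)%:E \is a fin_num)%E.
Proof.
move=> sf f0; rewrite (eq_esum _ (b := fun i => `|(EFin \o f) i|%E)).
  by rewrite -summableE.
by move=> i _ /=; rewrite ger0_norm.
Qed.

Let pos f i := Num.max (f i) 0.
Let neg f i := Num.max (- f i) 0.

Let posneg f i : f i = pos f i - neg f i.
Proof.
rewrite /pos /neg; have [h|h] := leP (f i) 0.
  by rewrite max_l ?oppr_ge0// sub0r opprK.
by rewrite max_r ?subr0// oppr_le0 ltW.
Qed.

Let pos0 f i : 0 <= pos f i. Proof. by rewrite le_max lexx orbT. Qed.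
Let neg0 f i : 0 <= neg f i. Proof. by rewrite le_max lexx orbT. Qed.

Let spos f : rsummable f -> rsummable (pos f).
Proof.
move=> sf; apply: (@rsummable_le _ (fun i => `|f i|)) => [i|].
  by rewrite ger0_norm// /pos ge_max ler_norm normr_ge0.
by rewrite /rsummable /summable; under eq_esum do rewrite /= normr_id.
Qed.

Let sneg f : rsummable f -> rsummable (neg f).
Proof.
move=> sf; apply: (@rsummable_le _ (fun i => `|f i|)) => [i|].
  by rewrite ger0_norm// /neg ge_max -normrN ler_norm normr_ge0.
by rewrite /rsummable /summable; under eq_esum do rewrite /= normr_id.
Qed.

(* The sum may be computed from any decomposition into summable
   nonnegative families. *)
Lemma rsumB f g : rsummable f -> rsummable g ->
  (forall i, 0 <= f i) -> (forall i, 0 <= g i) ->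
  rsum (fun i => f i - g i) =
  fine (\esum_(i in [set: I]) (f i)%:E) - fine (\esum_(i in [set: I]) (g i)%:E).
Proof.
move=> sf sg f0 g0.
have sN : rsummable (fun i => - g i) by move: sg; rewrite /rsummable summableN.
have sd := rsummableD sf sN.
have := esumB sf sg (fun i _ => f0 i) (fun i _ => g0 i).
rewrite (_ : esum _ ((EFin \o f) \- (EFin \o g))^\+%E =
   \esum_(i in [set: I]) (pos (fun i => f i - g i) i)%:E)%E; last first.
  by apply: eq_esum => i _; rewrite funeposE /= EFin_max.
rewrite (_ : esum _ ((EFin \o f) \- (EFin \o g))^\-%E =
   \esum_(i in [set: I]) (neg (fun i => f i - g i) i)%:E)%E; last first.
  by apply: eq_esum => i _; rewrite funenegE /= EFin_max.
move=> e; rewrite /rsum -[LHS]fineB ?e ?fineB//; apply: fin_num_esum => //;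
  by [exact: spos|exact: sneg|move=> i; rewrite le_max lexx orbT].
Qed.

Lemma rsum_ge0E f : (forall i, 0 <= f i) ->
  rsum f = fine (\esum_(i in [set: I]) (f i)%:E).
Proof.
move=> f0; rewrite /rsum.
rewrite (eq_esum _ (b := fun i => (f i)%:E)); last first.
  by move=> i _; rewrite max_l.
rewrite [X in _ - fine X](_ : _ = 0%E) ?subr0//.
by apply: esum1 => i _; rewrite max_r// oppr_le0.
Qed.

Lemma fine_esumD f g : rsummable f -> rsummable g ->
  (forall i, 0 <= f i) -> (forall i, 0 <= g i) ->
  fine (\esum_(i in [set: I]) (f i + g i)%:E) =
  fine (\esum_(i in [set: I]) (f i)%:E) + fine (\esum_(i in [set: I]) (g i)%:E).
Proof.
move=> sf sg f0 g0; rewrite -fineD ?fin_num_esum//; congr fine.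
rewrite -esumD//; by move=> i _; rewrite lee_fin.
Qed.

Lemma rsumD f g : rsummable f -> rsummable g ->
  rsum (fun i => f i + g i) = rsum f + rsum g.
Proof.
move=> sf sg.
rewrite (_ : (fun i => _) =
    (fun i => (pos f i + pos g i) - (neg f i + neg g i))); last first.
  by apply/funext => i; rewrite {1}posneg {1}(posneg g) opprD addrACA.
rewrite rsumB; [|exact/rsummableD/spos/sg/spos|
  exact/rsummableD/sneg/sg/sneg|by move=> i; rewrite addr_ge0|
  by move=> i; rewrite addr_ge0].
rewrite !fine_esumD//; [|exact: sneg|exact: sneg|exact: spos|exact: spos].
by rewrite opprD addrACA.
Qed.

Lemma rsumN f : rsummable f -> rsum (fun i => - f i) = - rsum f.
Proof.
move=> sf; rewrite [in RHS]/rsum opprB -(rsumB (sneg sf) (spos sf))//.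
by congr rsum; apply/funext => i; rewrite {1}posneg opprB.
Qed.

Lemma rsumZ c f : rsummable f -> rsum (fun i => c * f i) = c * rsum f.
Proof.
wlog c0 : c f / 0 <= c => [wl sf|sf].
  have [|/ltW c0] := leP 0 c; first by move=> ?; exact: wl.
  have sN : rsummable (fun i => - f i).
    by have := rsummableZ (-1) sf; under eq_fun do rewrite mulN1r.
  under eq_fun do rewrite -mulrNN.
  by rewrite (wl (- c)) ?oppr_ge0// rsumN// mulrNN.
rewrite (_ : (fun i => _) = (fun i => c * pos f i - c * neg f i)); last first.
  by apply/funext => i; rewrite -mulrBr -posneg.
rewrite rsumB; [|exact/rsummableZ/spos|exact/rsummableZ/sneg|
  by move=> i; rewrite mulr_ge0|by move=> i; rewrite mulr_ge0].
rewrite !esumZ//.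
rewrite !fineM ?fin_num_esum//; [|exact: sneg|exact: spos].
by rewrite -mulrBr.
Qed.

End Sums.

Section CSum.
Context (R : realType) (I : choiceType).
Implicit Types (F K : I -> R[i]).

Lemma csummableD F K : csummable F -> csummable K ->
  csummable (fun i => F i + K i).
Proof.
move=> [F1 F2] [K1 K2]; split.
  by under eq_fun do rewrite raddfD; exact: rsummableD.
by under eq_fun do rewrite raddfD; exact: rsummableD.
Qed.

Lemma csumD F K : csummable F -> csummable K ->
  csum (fun i => F i + K i) = csum F + csum K.
Proof.
move=> [F1 F2] [K1 K2]; rewrite /csum.
under eq_fun do rewrite raddfD; rewrite rsumD//.
by under [X in _ +i* rsum X]eq_fun do rewrite raddfD; rewrite rsumD.
Qed.

Lemma csumZ a F : csummable F -> csum (fun i => a * F i) = a * csum F.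
Proof.
case: a => a b [F1 F2]; rewrite /csum.
have -> : (fun i => complex.Re ((a +i* b) * F i)) =
    (fun i => a * complex.Re (F i) + (- b) * complex.Im (F i)).
  by apply/funext => i; case: (F i) => x y /=; rewrite mulNr.
have -> : (fun i => complex.Im ((a +i* b) * F i)) =
    (fun i => a * complex.Im (F i) + b * complex.Re (F i)).
  by apply/funext => i; case: (F i) => x y /=; rewrite addrC.
rewrite !rsumD ?rsumZ//; try exact: rsummableZ.
by rewrite mulNr.
Qed.

Lemma csum_conj F : csummable F -> csum (fun i => conjC (F i)) = conjC (csum F).
Proof.
move=> [F1 F2]; rewrite /csum.
have -> : (fun i => complex.Re (conjC (F i))) = (fun i => complex.Re (F i)).
  by apply/funext => i; case: (F i).
have -> : (fun i => complex.Im (conjC (F i))) = (fun i => - complex.Im (F i)).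
  by apply/funext => i; case: (F i).
by rewrite rsumN.
Qed.

End CSum.

(* For finite dimensional V, the Hilbert space l^2(G) (x) V is l^2(G; V): the
   tensor delta_x (x) v is the function with value v at x and 0 elsewhere. *)
Section L2.
Context (R : realType) (G : choiceType) (V : lmodType R[i])
  (dot : {dot V for conjC}).
Implicit Types (f : G -> V).

Let sq (v : V) : R := complex.Re (dot v v).

Definition sqsummable : {pred G -> V} :=
  fun f => `[< (\esum_(x in [set: G]) (complex.Re (dot (f x) (f x)))%:E < +oo)%E >].

Let sq_ge0 v : 0 <= sq v.
Proof. by have := dnorm_ge0 dot v; rewrite lecE => /andP[]. Qed.

Let dotsq v : dot v v = (sq v)%:C.
Proof.
have := dnorm_ge0 dot v; rewrite lecE /sq; case: (dot v v) => a b /=.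
by move=> /andP[/eqP-> _].
Qed.

Let sqsumP f : reflect (rsummable (fun x => sq (f x))) (f \in sqsummable).
Proof.
rewrite unfold_in; apply: (iffP (asboolP _)); rewrite /rsummable /summable.
  by apply: le_lt_trans; apply: le_esum => x _; rewrite /= ger0_norm.
by apply: le_lt_trans; apply: le_esum => x _; rewrite /= ger0_norm ?sq_ge0.
Qed.

Let sqD u v : sq (u + v) + sq (u - v) = 2 * sq u + 2 * sq v.
Proof.
rewrite /sq dnormD dnormB.
case: (dot u u) (dot v v) (dot u v) => a b [c d] [e f] /=; ring.
Qed.

Let sqZ a v : sq (a *: v) = complex.Re (`|a| ^+ 2) * sq v.
Proof.
rewrite {1}/sq dnormZ dotsq; case: a => a b.
by rewrite sqr_normc /= !mulr0 !subr0.
Qed.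

Fact sqsummable_submod_closed : submod_closed sqsummable.
Proof.
split=> [|a f g /sqsumP sf /sqsumP sg]; apply/sqsumP.
  rewrite /rsummable /summable esum1// => x _.
  by rewrite /= /sq linear0l normr0.
apply: (@rsummable_le _ _ _
  (fun x => 2 * complex.Re (`|a| ^+ 2) * sq (f x) + 2 * sq (g x))).
  move=> x; rewrite ger0_norm// -mulrA -sqZ -sqD lerDl; exact: sq_ge0.
by apply: rsummableD; apply: rsummableZ.
Qed.

HB.instance Definition _ :=
  GRing.isSubmodClosed.Build _ _ sqsummable sqsummable_submod_closed.

Record l2 := L2 { l2_val :> G -> V; _ : l2_val \in sqsummable }.

HB.instance Definition _ := [isSub for l2_val].
HB.instance Definition _ := [Choice of l2 by <:].
HB.instance Definition _ := [SubChoice_isSubLmodule of l2 by <:].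

Definition l2dot (f g : l2) : R[i] := csum (fun x => dot (f x) (g x)).

Let l2_sqsum (f : l2) : rsummable (fun x => sq (f x)).
Proof. by apply/sqsumP; case: f. Qed.

Let dotC u v : dot u v = conjC (dot v u).
Proof. by rewrite hermC /= expr0 mul1r. Qed.

Let Re_dot_le u v : `|complex.Re (dot u v)| <= sq u + sq v.
Proof.
have E (w : V) : sq (u + w) = sq u + sq w + 2 * complex.Re (dot u w).
  rewrite /sq dnormD.
  case: (dot u u) (dot w w) (dot u w) => a b [c d] [e f] /=; ring.
have := sq_ge0 (u + v); have := sq_ge0 (u - v); rewrite !E.
have -> : sq (- v) = sq v by rewrite /sq hnormN.
rewrite linearNr raddfN /= => h1 h2.
have u0 := sq_ge0 u; have v0 := sq_ge0 v.
by rewrite ler_norml; apply/andP; split; lra.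
Qed.

Lemma l2_csummable (f g : l2) : csummable (fun x => dot (f x) (g x)).
Proof.
have s (f' g' : l2) : rsummable (fun x => complex.Re (dot (f' x) (g' x))).
  apply: (rsummable_le (fun x => Re_dot_le (f' x) (g' x))).
  by apply: rsummableD; exact: l2_sqsum.
split; first exact: s.
have := s (((0 : R) -i* 1) *: f) g; congr rsummable; apply/funext => x.
rewrite /= linearZl_LR /=; case: (dot (f x) (g x)) => a b /=; ring.
Qed.

Fact l2dot_bilinear : bilinear_for *%R (conjC \; *%R) l2dot.
Proof.
have lin (h : l2) : GRing.linear_for *%R (l2dot^~ h).
  move=> a f g; rewrite /l2dot.
  have sZ : csummable (fun x => a * dot (f x) (h x)).
    by have := l2_csummable (a *: f) h; under eq_fun do rewrite /= linearZl_LR.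
  under eq_fun do rewrite /= linearPl.
  by rewrite csumD ?csumZ//; exact: l2_csummable.
have C (f g : l2) : l2dot f g = conjC (l2dot g f).
  rewrite /l2dot -csum_conj; last exact: l2_csummable.
  by congr csum; apply/funext => x; rewrite dotC.
split=> h a f g /=; first exact: lin.
by rewrite C lin rmorphD rmorphM /= -!C.
Qed.

HB.instance Definition _ := bilinear_isBilinear.Build R[i] l2 l2 R[i]
  *%R (conjC \; *%R) l2dot l2dot_bilinear.

Fact l2dot_hermitian (f g : l2) : l2dot f g = (-1) ^+ false * conjC (l2dot g f).
Proof.
rewrite expr0 mul1r /l2dot -csum_conj; last exact: l2_csummable.
by congr csum; apply/funext => x; rewrite dotC.
Qed.

HB.instance Definition _ := isHermitianSesquilinear.Build R[i] l2 false conjC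
  l2dot l2dot_hermitian.

Fact l2dot_gt0 (f : l2) : f != 0 -> 0 < l2dot f f.
Proof.
move=> f0; rewrite /l2dot /csum.
rewrite (_ : (fun x => complex.Im _) = fun=> 0); last first.
  by apply/funext => x; rewrite dotsq.
rewrite [X in _ +i* X](rsum_ge0E (fun=> lexx 0)) esum1//= ltcE /= eqxx /=.
rewrite rsum_ge0E; last by move=> x; exact: sq_ge0.
rewrite lt_neqAle fine_ge0 ?andbT; last first.
  by apply: esum_ge0 => x _; rewrite lee_fin sq_ge0.
apply: contra f0 => /eqP/esym/eqP; rewrite fine_eq0; last first.
  by apply: fin_num_esum (l2_sqsum f) _ => x; exact: sq_ge0.
move=> /eqP f0; apply/eqP/val_inj/funext => x /=.
apply/eqP; rewrite -(dnorm_eq0 dot) dotsq.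
have : ((sq (f x))%:E <= 0)%E.
  rewrite -f0; apply: esum_ge; exists [set x]; first by split.
  by rewrite fsbig_set1.
by rewrite lee_fin => h; rewrite (@le_anti _ _ (sq (f x)) 0) ?h ?sq_ge0 ?eqxx.
Qed.

HB.instance Definition _ := isDotProduct.Build R[i] l2 l2dot l2dot_gt0.

End L2.

(* A possibly unbounded operator; the values of [op_app] outside [dom] are
   irrelevant. *)
Record operator (H : Type) := Operator { dom : set H; op_app :> H -> H }.

HB.instance Definition _ (H : Type) := gen_eqMixin (operator H).
HB.instance Definition _ (H : Type) := gen_choiceMixin (operator H).

Section Operators.
Context (R : realType) (H : lmodType R[i]) (dot : {dot H for conjC}).
Implicit Types (T : operator H) (u v w : H) (B : set H).

Definition dense_in_norm (A : set H) : Prop :=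
  forall u (e : R), 0 < e -> exists2 v, A v & norm_of dot (u - v) < e.

(* T is densely defined and the graphs of T and of its adjoint coincide. *)
Definition self_adjoint T : Prop :=
  dense_in_norm (dom T) /\
  forall u v, (dom T u /\ T u = v) <->
              (forall w, dom T w -> dot (T w) u = dot w v).

Definition one_plus_square T : operator H :=
  Operator [set u | dom T u /\ dom T (T u)] (fun u => u + T (T u)).

(* [is_fun f A T] says that T = f(A).  It is meant for self-adjoint A having an
   orthonormal basis of eigenvectors (such as I + D^2 with D of compact
   resolvent, as in a spectral triple): f(A) is then the only self-adjoint
   operator that acts as f(r) on the r-eigenvectors of A. *)
Definition is_fun (f : R -> R) (A T : operator H) : Prop :=
  self_adjoint T /\
  forall (r : R) u, dom A u -> A u = r%:C *: u ->
    dom T u /\ T u = (f r)%:C *: u.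

Definition op_power (A : operator H) (s : R) : operator H :=
  xget (Operator setT id) [set T | is_fun (fun r => r `^ s) A T].

Definition orthonormal_basis B : Prop :=
  {in B &, forall u v, dot u v = (u == v)%:R} /\
  dense_in_norm [set u | exists (s : seq H) (a : H -> R[i]),
    {subset s <= B} /\ u = \sum_(v <- s) a v *: v].

(* The trace, in [0, +oo], of a nonnegative self-adjoint operator; it does not
   depend on the orthonormal basis chosen in the domain of T. *)
Definition trace T : \bar R :=
  let B := xget set0 [set B | orthonormal_basis B /\ B `<=` dom T] in
  (\esum_(u in B) (complex.Re (dot (T u) u))%:E)%E.

End Operators.

(* The data (A, H, D) of a spectral triple, with the representation of A on H;
   its axioms play no role in summability and are not recorded. *)
Record triple (R : realType) := Triple {
  triple_algebra : Type;
  triple_space : lmodType R[i];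
  triple_dot : {dot triple_space for conjC};
  triple_rep : triple_algebra -> triple_space -> triple_space;
  triple_dirac : operator triple_space
}.

Section Zeta.
Context (R : realType) (S : triple R).

Definition zeta (t : R) : \bar R :=
  trace (triple_dot S)
    (op_power (triple_dot S) (one_plus_square (triple_dirac S)) (- t / 2)).

Definition finitely_summable : Prop := exists t : R, (zeta t < +oo)%E.

Definition abscissa : \bar R :=
  ereal_inf [set t%:E | t in [set t : R | 0 < t /\ (zeta t < +oo)%E]].

End Zeta.

Section Triple.
Context (R : realType) (G : groupType) (V : vectType R[i])
  (dot : {dot V for conjC}) (ell : G -> 'End(V)).

Fact sqsummable_translate (g : G) (xi : l2 G dot) :
  (fun x => xi (g^-1 * x)%g) \in sqsummable dot.
Proof.
have := valP xi; rewrite !unfold_in => /asboolP h; apply/asboolP.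
rewrite -(@reindex_esum R G G setT setT (fun x => (g^-1 * x)%g)
  (fun x => (complex.Re (dot (xi x) (xi x)))%:E))//.
rewrite setTT_bijective; exists (fun x => (g * x)%g) => x.
  exact: mulVKg.
exact: mulKg.
Qed.

Definition translate (g : G) (xi : l2 G dot) : l2 G dot :=
  L2 (sqsummable_translate g xi).

(* CG is the space of finitely supported functions on G, and
   lambda(delta_g)(delta_x (x) v) = delta_{gx} (x) v. *)
Definition lambda (a : {fsfun G -> R[i] with 0}) (xi : l2 G dot) : l2 G dot :=
  \sum_(g <- finsupp a) a g *: translate g xi.

Definition mult_op : operator (l2 G dot) :=
  Operator
    [set xi : l2 G dot | (fun x => ell x (xi x)) \in sqsummable dot]
    (fun xi => insubd (0 : l2 G dot) (fun x => ell x (xi x))).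

Definition group_triple : triple R := Triple (@l2dot R G V dot) lambda mult_op.

End Triple.

Section Growth.
Context (R : realType) (V : vectType R[i]) (dot : {dot V for conjC}).
Implicit Types (a : 'End(V)).

Definition self_adjoint_end a : Prop :=
  forall u v, dot (a u) v = dot u (a v).

(* Only used for self-adjoint a, whose spectrum is real. *)
Definition Sp a : set R := [set t : R | passmx.leigenvalue a t%:C].

Definition positive_end a : Prop := forall u, 0 <= dot (a u) u.

(* |a| is the positive square root of a^* a, which is a^2 for self-adjoint a. *)
Definition abs_end a : 'End(V) :=
  xget 0 [set p : 'End(V) | positive_end p /\ (p \o p = a \o a)%VF].

Context (G : groupType) (ell : G -> 'End(V)).

Definition translation_bounded : Prop :=
  forall y : G, exists M : R, forall x v,
    norm_of dot ((ell x - ell (y^-1 * x)%g) v) <= M * norm_of dot v.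

Definition spectrum_union : set R := \bigcup_(x in [set: G]) Sp (ell x).

Definition proper_fun : Prop :=
  [/\ forall g, ell g = 0 <-> g = 1%g,
      forall a b : R, finite_set (spectrum_union `&` `[a, b]) &
      forall t, spectrum_union t -> finite_set [set x | Sp (ell x) t]].

(* Spectra are finite and, if V <> 0, nonempty, so that inf is a minimum. *)
Definition growth_ball (n : nat) : set G :=
  [set g | inf (Sp (abs_end (ell g))) <= n%:R].

(* [growth_ball n] is finite for proper ell; the cardinal used here is 0 on
   infinite sets. *)
Definition growth_card (n : nat) : nat := #|` fset_set (growth_ball n)|.

Definition polynomial_growth : Prop :=
  exists (c : R) (k : nat),
    \forall n \near \oo, (growth_card n)%:R <= c * n%:R ^+ k.

Definition growth : \bar R :=
  limn_esup (fun n => (ln (growth_card n)%:R / ln (n%:R : R))%:E).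

End Growth.

(* Main.v *)
(* Choose for every x an orthonormal eigenbasis (e_{x,i}) of ell x, with
   eigenvalues l_{x,i}. The vectors delta_x (x) e_{x,i} form an orthonormal
   basis that diagonalises I + M_ell^2, and the trace can be computed in it
   (Parseval and Tonelli), so zeta(t) = sum_{x,i} (1 + l_{x,i}^2)^(-t/2).
   Since x lies in B_k iff |l_{x,i}| <= k for some i, keeping only the x in B_k
   gives #B_k (1 + k^2)^(-t/2) <= zeta(t), hence d_G <= t. Conversely, if
   #B_k <= C k^s with s < t, comparing each |l_{x,i}| with the least power of 2
   above it bounds zeta(t) by a multiple of
   sum_j #B_{2^j} 2^(-jt) <= C sum_j 2^(j(s-t)), which is finite. *)

Require Import Defs.
From HB Require Import structures.
From mathcomp Require Import all_boot all_order all_algebra finmap.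
From mathcomp Require Import all_classical all_reals all_analysis complex.
From mathcomp Require Import ring lra.

Set Implicit Arguments.
Unset Strict Implicit.
Unset Printing Implicit Defensive.

Import Order.TTheory GRing.Theory Num.Theory.
Local Open Scope classical_set_scope.
Local Open Scope ring_scope.
Local Open Scope complex_scope.

Local Notation conjC := Num.conj.

(** * Squared moduli of complex numbers and elementary rules for inner products *)

Lemma conjC_real (R : realType) (x : R) : conjC x%:C = x%:C.
Proof. exact: conjc_real. Qed.

Definition nsq (R : realType) (z : R[i]) : R := complex.Re (z * conjC z).

Lemma mul_conj_nsq (R : realType) (z : R[i]) : z * conjC z = (nsq z)%:C.
Proof. by case: z => x y; rewrite /nsq /=; congr (_ +i* _); ring. Qed.

Lemma nsq_ge0 (R : realType) (z : R[i]) : 0 <= nsq z.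
Proof. by case: z => x y; rewrite /nsq /= mulrN opprK addr_ge0// -expr2 sqr_ge0. Qed.

Section Dot.
Context (R : realType) (V : lmodType R[i]) (dot : {dot V for conjC}).
Implicit Types u v w : V.

Definition sqn v : R := complex.Re (dot v v).

Lemma sqn_ge0 v : 0 <= sqn v.
Proof. by have := dnorm_ge0 dot v; rewrite lecE => /andP[]. Qed.

Lemma dot_sqn v : dot v v = (sqn v)%:C.
Proof.
have := dnorm_ge0 dot v; rewrite lecE /sqn; case: (dot v v) => a b /=.
by move=> /andP[/eqP-> _].
Qed.

Lemma sqn_eq0 v : (sqn v == 0) = (v == 0).
Proof.
by rewrite -(dnorm_eq0 dot) dot_sqn; apply/eqP/eqP => [->//|[]].
Qed.

Lemma dotC u v : dot u v = conjC (dot v u).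
Proof. by rewrite hermC /= expr0 mul1r. Qed.

Lemma dotZl c u v : dot (c *: u) v = c * dot u v.
Proof. by rewrite linearZl_LR. Qed.

Lemma dotZr c u v : dot u (c *: v) = conjC c * dot u v.
Proof. by rewrite linearZr_LR. Qed.

Lemma norm_of_sqn v : norm_of dot v = Num.sqrt (sqn v).
Proof. by []. Qed.

End Dot.

(** * The spectral theorem for self-adjoint endomorphisms in finite dimension *)

Section Spectral.
Context (R : realType) (V : vectType R[i]) (dot : {dot V for conjC}).
Implicit Types (a : 'End(V)) (U : {vspace V}).

(** Restricting [a] to the stable space gives an endomorphism [f] of [subvs_of U], whose matrix has
    an eigenvalue because [R[i]] is algebraically closed. *)
Lemma stable_eigenvector a U : (a @: U <= U)%VS -> U != 0%VS ->
  exists (c : R[i]) (u : V), [/\ u \in U, u != 0 & a u = c *: u].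
Proof.
move=> aU U0.
pose f : 'End(subvs_of U) := (linfun (vsproj U) \o a \o linfun vsval)%VF.
have fE w : vsval (f w) = a (vsval w).
  rewrite /f !comp_lfunE !lfunE /= vsprojK//.
  exact/(subvP aU)/memv_img/subvsP.
have eb := vbasisP {: subvs_of U}.
have d0 : (0 < \dim {: subvs_of U})%N by rewrite dimvf /dim /= lt0n dimv_eq0.
pose b := vbasis {: subvs_of U}.
have [c hc] := eigenvalue_closed (passmx.mxof b b f) d0.
have : passmx.leigenspace f c != 0%VS.
  by rewrite (passmx.leigenspaceE eb) passmx.vsof_eq0.
move=> h; have w0 := h; rewrite -vpick0 in w0.
exists c, (vsval (vpick (passmx.leigenspace f c))); split.
- exact: subvsP.
- by apply: contra w0 => /eqP e; apply/eqP/val_inj; rewrite /= e.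
- have := memv_pick (passmx.leigenspace f c).
  rewrite memv_ker add_lfunE opp_lfunE scale_lfunE id_lfunE subr_eq0 => /eqP e.
  by rewrite -fE e.
Qed.

Lemma sa_eigenvalue_real a c u : self_adjoint_end dot a -> u != 0 ->
  a u = c *: u -> c = (complex.Re c)%:C.
Proof.
move=> sa u0 e; have := sa u u; rewrite e dotZl dotZr.
move/(mulIf _) => -/(_ _)/[!dnorm_eq0]/(_ u0) h.
by case: c h {e} => x y /= [] /eqP; rewrite -addr_eq0 -mulr2n mulrn_eq0 /= => /eqP->.
Qed.

(** Completeness is stated as an expansion formula, so that identities between endomorphisms reduce
    to coordinates. *)
Definition eigenbasis n (a : 'End(V)) (e : 'I_n -> V) (l : 'I_n -> R) : Prop :=
  [/\ forall i j, dot (e i) (e j) = (i == j)%:R,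
      forall i, a (e i) = (l i)%:C *: e i &
      forall v, v = \sum_i dot v (e i) *: e i].

(** Induction on the dimension: an eigenvector [u] of [a] in [U] is split off, and [U :&: orthov dot
    <[u]>] is again stable because [a] is self-adjoint with a real eigenvalue at [u]. Each vector is
    stored together with its eigenvalue. *)
Lemma exists_eigenseq a n U : self_adjoint_end dot a ->
  (a @: U <= U)%VS -> \dim U = n ->
  exists s : seq (V * R), [/\ size s = n, {in s, forall p, p.1 \in U},
    orthonormal dot [seq p.1 | p <- s] &
    {in s, forall p, a p.1 = (p.2)%:C *: p.1}].
Proof.
move=> sa; elim: n U => [|n IH] U aU dU.
  exists [::]; split=> //.
have U0 : U != 0%VS by rewrite -dimv_eq0 dU.
have [c [u [uU u0 au]]] := stable_eigenvector aU U0.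
have cr := sa_eigenvalue_real sa u0 au.
have uN : u \notin orthov dot U.
  by apply/mem_orthovPn; exists u; rewrite ?dnorm_eq0.
have dW := eq_dim_orthov1 uN; rewrite dU /= in dW.
have aW : (a @: (U :&: orthov dot <[u]>) <= U :&: orthov dot <[u]>)%VS.
  apply/subvP => _ /memv_imgP[w /memv_capP[wU wu] ->].
  rewrite memv_cap (subvP aU) ?memv_img//= mem_orthov1.
  apply/eqP; apply: (etrans (sa w u)); rewrite au dotZr.
  by move: wu; rewrite mem_orthov1 => /eqP wu; rewrite [dot w u]wu mulr0.
have [s [ss sU so se]] := IH _ aW (esym dW).
pose k : R := (Num.sqrt (sqn dot u))^-1.
have k0 : Num.sqrt (sqn dot u) != 0.
  by rewrite sqrtr_eq0 -ltNge lt_neqAle sqn_ge0 eq_sym sqn_eq0 u0.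
exists ((k%:C *: u, complex.Re c) :: s); split.
- by rewrite /= ss.
- move=> p; rewrite inE => /orP[/eqP->|/sU]; first by rewrite /= memvZ.
  by rewrite memv_cap => /andP[].
- rewrite /= -cat1s orthonormal_cat so /=; apply/andP; split.
    rewrite /orthonormal /= !andbT; apply/eqP; rewrite -[LHS]/(dot _ _).
    rewrite dotZl dotZr dot_sqn conjC_real -!rmorphM /=.
    rewrite /k mulrA -expr2 exprVn sqr_sqrtr ?sqn_ge0// mulVf ?sqn_eq0//.
  rewrite andbT; apply/allP => y /mapP[p /sU].
  rewrite memv_cap mem_orthov1 => /andP[_ /eqP pu] -> /=; apply/eqP.
  by rewrite -[LHS]/(dot _ _) dotZl dotC [dot _ _]pu conjC0 mulr0.
- move=> p; rewrite inE => /orP[/eqP->|/se//] /=.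
  by rewrite linearZ /= au scalerA mulrC -scalerA -cr.
Qed.

Lemma exists_eigenbasis a : self_adjoint_end dot a ->
  exists (e : 'I_(\dim {:V}) -> V) (l : 'I_(\dim {:V}) -> R), eigenbasis a e l.
Proof.
move=> sa; have [s [ss _ so se]] := exists_eigenseq sa (subvf _) (erefl (\dim {:V})).
pose p (i : 'I_(\dim {:V})) := nth (0, 0) s i.
have ps i : p i \in s by rewrite mem_nth ?ss.
have orth i j : dot (p i).1 (p j).1 = (i == j)%:R.
  move/orthonormalP : so => [us /(_ _ _ (map_f _ (ps i)) (map_f _ (ps j)))->].
  have E k : (p k).1 = nth 0 [seq q.1 | q <- s] k.
    by rewrite (nth_map (0, 0)) ?ss.
  by rewrite !E nth_uniq// size_map ss.
exists (fun i => (p i).1), (fun i => (p i).2); split=> //.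
  by move=> i; exact: se.
move=> v.
have bs : basis_of fullv [seq q.1 | q <- s].
  rewrite basisEfree (orthonormal_free so) subvf /=.
  by rewrite size_map ss.
have vs : v \in <<[seq q.1 | q <- s]>>%VS by rewrite (span_basis bs) memvf.
have [c vE] : exists c : 'I_(\dim {:V}) -> R[i], v = \sum_i c i *: (p i).1.
  have st : size [seq q.1 | q <- s] == \dim {:V} by rewrite size_map ss.
  exists (fun i => coord (Tuple st) i v).
  rewrite {1}(@coord_span _ _ _ (Tuple st) v vs); apply: eq_bigr => i _.
  by rewrite (nth_map (0, 0)) ?ss.
rewrite {1}vE; apply: eq_bigr => i _; congr (_ *: _).
rewrite vE linear_sumlz (bigD1 i)//= big1 ?addr0 => [|j ji].
  by rewrite linearZl_LR /= orth eqxx mulr1.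
by rewrite linearZl_LR /= orth (negPf ji) mulr0.
Qed.

End Spectral.

(** * Endomorphisms that are diagonal in a given family of vectors *)

Section DiagEnd.
Context (R : realType) (V : vectType R[i]) (dot : {dot V for conjC}) (n : nat).
Implicit Types (e : 'I_n -> V) (g : 'I_n -> R).

Definition diag_fun e g (v : V) : V := \sum_i ((g i)%:C * dot v (e i)) *: e i.

Fact diag_fun_linear e g : linear (diag_fun e g).
Proof.
move=> c u v; rewrite /diag_fun scaler_sumr -big_split; apply: eq_bigr => i _ /=.
by rewrite linearPl /= mulrDr scalerDl scalerA mulrCA.
Qed.

HB.instance Definition _ e g := GRing.isLinear.Build R[i] V V _ (diag_fun e g)
  (diag_fun_linear e g).

Definition diag_end e g : 'End(V) := linfun (diag_fun e g).

Lemma diag_endE e g v : diag_end e g v = \sum_i ((g i)%:C * dot v (e i)) *: e i.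
Proof. by rewrite lfunE. Qed.

Lemma dot_diag_end e g u v :
  dot (diag_end e g u) v = \sum_i (g i)%:C * (dot u (e i) * conjC (dot v (e i))).
Proof.
rewrite diag_endE linear_sumlz; apply: eq_bigr => i _ /=.
by rewrite dotZl [dot (e i) v]dotC mulrA.
Qed.

Lemma diag_end_self_adjoint e g : self_adjoint_end dot (diag_end e g).
Proof.
move=> u v; rewrite dot_diag_end [RHS]dotC dot_diag_end rmorph_sum /=.
by apply: eq_bigr => i _; rewrite !rmorphM /= conjCK conjC_real; ring.
Qed.

Lemma Re_dot_diag_end e g v :
  complex.Re (dot (diag_end e g v) v) = \sum_i g i * nsq (dot v (e i)).
Proof.
rewrite dot_diag_end raddf_sum; apply: eq_bigr => i _.
by rewrite mul_conj_nsq -rmorphM.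
Qed.

Lemma diag_end_positive e g : (forall i, 0 <= g i) ->
  positive_end dot (diag_end e g).
Proof.
move=> g0 v; rewrite dot_diag_end sumr_ge0// => i _.
by rewrite mul_conj_nsq -rmorphM lecR mulr_ge0// nsq_ge0.
Qed.

Lemma diag_end_eigenvector e g j : (forall i j, dot (e i) (e j) = (i == j)%:R) ->
  diag_end e g (e j) = (g j)%:C *: e j.
Proof.
move=> oe; rewrite diag_endE (bigD1 j)//= big1 ?addr0 => [|i ij].
  by rewrite oe eqxx mulr1.
by rewrite oe eq_sym (negPf ij) mulr0 scale0r.
Qed.

End DiagEnd.

(** * Spectra of [a] and of its absolute value, in terms of the eigenvalues [l] *)

Section Spectrum.
Context (R : realType) (V : vectType R[i]) (dot : {dot V for conjC}) (n : nat).
Context (a : 'End(V)) (e : 'I_n -> V) (l : 'I_n -> R).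
Hypothesis ael : eigenbasis dot a e l.

Lemma eigenbasis_end_ext (f g : 'End(V)) : (forall i, f (e i) = g (e i)) -> f = g.
Proof.
case: ael => _ _ ex fg; apply/lfunP => v; rewrite (ex v) !linear_sum.
by apply: eq_bigr => i _; rewrite !linearZ /= fg.
Qed.

Lemma eigenbasis_diag : a = diag_end dot e l.
Proof.
apply: eigenbasis_end_ext => i; case: ael => oe ae _.
by rewrite ae diag_end_eigenvector.
Qed.

Lemma eigenbasis_neq0 i : e i != 0.
Proof. by case: ael => oe _ _; rewrite -(dnorm_eq0 dot) [dot _ _]oe eqxx oner_eq0. Qed.

Lemma eigenbasis_coord v i : dot (a v) (e i) = (l i)%:C * dot v (e i).
Proof.
rewrite [in LHS]eigenbasis_diag diag_end_self_adjoint -eigenbasis_diag.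
by case: ael => _ -> _; rewrite dotZr conjC_real.
Qed.

Lemma eigenbasis_coordP v : v != 0 -> exists i, dot v (e i) != 0.
Proof.
move=> v0; apply/existsP; apply: contraNT v0 => /existsPn h.
case: ael => _ _ ex; apply/eqP; rewrite (ex v) big1// => i _.
by have := h i; rewrite negbK => /eqP->; rewrite scale0r.
Qed.

Lemma SpP (b : 'End(V)) t : Sp b t <-> exists2 v, v != 0 & b v = t%:C *: v.
Proof.
rewrite /Sp /= /passmx.leigenvalue /passmx.leigenspace; split=> [h|[v v0 bv]].
  exists (vpick (lker (b - t%:C *: \1%VF))); first by rewrite vpick0.
  have := memv_pick (lker (b - t%:C *: \1%VF)).
  by rewrite memv_ker add_lfunE opp_lfunE scale_lfunE id_lfunE subr_eq0 => /eqP.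
apply: contra v0 => /eqP k0; rewrite -memv0 -k0 memv_ker.
by rewrite add_lfunE opp_lfunE scale_lfunE id_lfunE subr_eq0 bv.
Qed.

Lemma Sp_eigenbasis : Sp a = range l.
Proof.
apply/seteqP; split => [t /SpP[v v0 av]|_ [i _ <-]]; last first.
  by apply/SpP; exists (e i); [exact: eigenbasis_neq0|by case: ael].
have [i vi] := eigenbasis_coordP v0; exists i => //.
by have := eigenbasis_coord v i; rewrite av dotZl => /(mulIf vi) /complexI ->.
Qed.

(** Since [abs_end] is an [xget] choice, a positive square root of $a^2$ has to be exhibited: the
    diagonal endomorphism with entries $|l_i|$. *)
Lemma abs_endP : positive_end dot (abs_end dot a) /\
  (abs_end dot a \o abs_end dot a = a \o a)%VF.
Proof.
rewrite /abs_end; case: xgetP => [p -> //|].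
move=> /(_ (diag_end dot e (fun i => `|l i|))) []; split.
  by apply: diag_end_positive => i; exact: normr_ge0.
apply: eigenbasis_end_ext => i; case: ael => oe ae _.
rewrite !comp_lfunE diag_end_eigenvector// ae !linearZ /= ae.
rewrite diag_end_eigenvector// !scalerA -!rmorphM /=.
by rewrite -normrM ger0_norm// -expr2 sqr_ge0.
Qed.

(** Writing p for the absolute value, the argument rests on $p \ge 0$ and $p^2 = a^2$. If $p v = t
    v$, a nonzero coordinate of v gives $t^2 = l_i^2$ with $t \ge 0$. Conversely $p e_i + |l_i|
    e_i$, if nonzero, is an eigenvector of p for $|l_i|$; if it is zero, positivity forces $l_i = 0$
    and $e_i$ itself is one. *)
Lemma Sp_abs_end : Sp (abs_end dot a) = range (fun i => `|l i|).
Proof.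
have [p0 pp] := abs_endP; set p := abs_end dot a in p0 pp *.
have ppE v : p (p v) = a (a v) by rewrite -!comp_lfunE pp.
have sgn t v : v != 0 -> p v = t%:C *: v -> 0 <= t.
  move=> v0 pv; have := p0 v; rewrite pv dotZl dot_sqn -rmorphM lecR.
  by rewrite pmulr_lge0// lt_neqAle eq_sym sqn_eq0 v0 sqn_ge0.
apply/seteqP; split => [t /SpP[v v0 pv]|_ [i _ <-]]; last first.
  apply/SpP; have := eigenbasis_neq0 i; case: ael => _ ae _ e0.
  have [u0|u0] := eqVneq (p (e i) + `|l i|%:C *: e i) 0.
    have pe : p (e i) = (- `|l i|)%:C *: e i.
      by rewrite rmorphN /= scaleNr; apply/eqP; rewrite -addr_eq0 u0.
    have := sgn _ _ e0 pe; rewrite oppr_ge0 normr_le0 => /eqP l0.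
    by exists (e i) => //; rewrite pe l0 normr0 oppr0.
  exists (p (e i) + `|l i|%:C *: e i) => //.
  rewrite linearD linearZ /= ppE ae linearZ /= ae scalerA -rmorphM /=.
  rewrite scalerDr scalerA -rmorphM /= addrC; congr (_ + _%:C *: _).
  by rewrite -normrM ger0_norm// -expr2 sqr_ge0.
have t0 := sgn _ _ v0 pv.
have [i vi] := eigenbasis_coordP v0; exists i => //.
have := congr1 (dot^~ (e i)) (ppE v).
rewrite /= pv linearZ /= pv scalerA dotZl !eigenbasis_coord mulrA => /(mulIf vi).
rewrite -!rmorphM => /complexI /= tl.
by apply/eqP; rewrite -(@eqrXn2 _ 2)// real_normK ?num_real// !expr2 tl.
Qed.

Lemma inf_Sp_abs_end_le (c : R) : (0 < n)%N ->
  inf (Sp (abs_end dot a)) <= c <-> exists i, `|l i| <= c.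
Proof.
move=> n0; rewrite Sp_abs_end.
have [i0 _ i0P] : exists2 i0, true & forall i, `|l i0| <= `|l i|.
  case: (arg_minP (fun i => `|l i|) (erefl : xpredT (Ordinal n0))) => i0 _ h.
  by exists i0 => // i; exact: h.
have -> : inf (range (fun i => `|l i|)) = `|l i0|.
  apply/eqP; rewrite eq_le; apply/andP; split.
    apply: ge_inf; last by exists i0.
    by exists (`|l i0|) => _ [i _ <-].
  by apply: lb_le_inf; [exists (`|l i0|), i0|move=> _ [i _ <-]].
split=> [h|[j]]; first by exists i0.
exact: le_trans.
Qed.

End Spectrum.

Lemma nsq_conj (R : realType) (z : R[i]) : nsq (conjC z) = nsq z.
Proof. by rewrite /nsq conjCK mulrC. Qed.

Lemma nsq0 (R : realType) : nsq (0 : R[i]) = 0.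
Proof. by rewrite /nsq mul0r. Qed.

(** * Bessel's inequality and Parseval's identity *)

Section Parseval.
Context (R : realType) (H : lmodType R[i]) (dot : {dot H for conjC}).
Implicit Types (u v w : H) (B : set H) (s : seq H).

Definition orthonormal_set B := {in B &, forall u v, dot u v = (u == v)%:R}.

(** Completing the square in each coefficient. Taking [a v] to be [dot w v] kills the last sum and
    gives Bessel; arbitrary [a] is what density provides in Parseval. *)
Lemma sqn_sub_comb B s (a : H -> R[i]) w : orthonormal_set B -> uniq s ->
  {subset s <= B} ->
  sqn dot (w - \sum_(v <- s) a v *: v) =
  sqn dot w - \sum_(v <- s) nsq (dot w v) + \sum_(v <- s) nsq (dot w v - a v).
Proof.
move=> oB us sB; set p := \sum_(v <- s) _.
have wp : dot w p = \sum_(v <- s) conjC (a v) * dot w v.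
  by rewrite linear_sumr; apply: eq_bigr => v _; exact: dotZr.
have pp : dot p p = \sum_(v <- s) a v * conjC (a v).
  rewrite [in LHS]/p linear_sumlz big_seq [RHS]big_seq; apply: eq_bigr => v vs /=.
  rewrite dotZl; congr (_ * _).
  rewrite linear_sumr (bigD1_seq v)//= big_seq_cond big1 ?addr0 => [|u /andP[us' uv]].
    by rewrite [LHS]dotZr oB ?sB// eqxx mulr1.
  by rewrite [LHS]dotZr oB ?sB// eq_sym (negPf uv) mulr0.
rewrite /sqn dnormB !raddfB !raddfD /= wp pp rmorph_sum /= !raddf_sum /=.
rewrite -!addrA; congr (_ + _).
rewrite -!big_split /=; apply: eq_bigr => v _.
rewrite /nsq; case: (dot w v) (a v) => x y [z t] /=; ring.
Qed.

Lemma bessel_seq B s w : orthonormal_set B -> uniq s -> {subset s <= B} ->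
  \sum_(v <- s) nsq (dot w v) <= sqn dot w.
Proof.
move=> oB us sB; have := sqn_ge0 dot (w - \sum_(v <- s) dot w v *: v).
rewrite (sqn_sub_comb _ _ oB)// [X in _ + X]big1 ?addr0 ?subr_ge0// => v _.
by rewrite subrr nsq0.
Qed.

(** The combinations in [orthonormal_basis] may repeat vectors; merging repetitions yields the
    duplicate-free list that [sqn_sub_comb] requires. *)
Lemma comb_undup s (a : H -> R[i]) :
  \sum_(v <- s) a v *: v = \sum_(v <- undup s) (a v *+ count_mem v s) *: v.
Proof.
rewrite -big_undup_iterop_count; apply: eq_bigr => v _.
by rewrite -scalerMnl.
Qed.

Lemma parseval B w : orthonormal_basis dot B ->
  (\esum_(u in B) (nsq (dot w u))%:E = (sqn dot w)%:E)%E.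
Proof.
move=> [oB dB]; apply/eqP; rewrite eq_le; apply/andP; split.
  apply: ge_ereal_sup => _ [A [fA AB] <-].
  rewrite fsbig_finite// sumEFin lee_fin (bessel_seq _ oB (fset_uniq _))// => u.
  by rewrite in_fset_set// !inE => /AB.
apply/lee_addgt0Pr => e e0.
(* Approximating within the square root of [e] makes the squared distance less than [e]; by
   [sqn_sub_comb] the Bessel defect over the finite list is then below [e] too. *)
have [u [s [a [sB ->]]] ws] := dB w (Num.sqrt e) (eqbRL (sqrtr_gt0 e) e0).
move: ws; rewrite norm_of_sqn ltr_sqrt// comb_undup.
rewrite (sqn_sub_comb _ _ oB) ?undup_uniq//; last first.
  by move=> v; rewrite mem_undup => /sB.
move=> h; have {h} : sqn dot w < \sum_(v <- undup s) nsq (dot w v) + e.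
  have h0 : 0 <= \sum_(v <- undup s) nsq (dot w v - a v *+ count_mem v s).
    by apply: sumr_ge0 => v _; exact: nsq_ge0.
  lra.
move=> h; apply: (@le_trans _ _ (\sum_(v <- undup s) nsq (dot w v) + e)%:E).
  by rewrite lee_fin ltW.
rewrite EFinD leeD2r//; apply: esum_ge; exists [set` undup s].
  by split; [exact: finite_seq|move=> v /=; rewrite mem_undup => /sB; rewrite inE].
by rewrite -fsbig_seq ?undup_uniq// sumEFin.
Qed.

End Parseval.

(** * Unordered sums: Tonelli's interchange, and families supported at one point *)

Lemma esum_swap (R : realType) (S T : choiceType) (A : set S) (B : set T)
    (F : S -> T -> \bar R) : (forall i j, 0 <= F i j)%E ->
  (\esum_(i in A) \esum_(j in B) F i j = \esum_(j in B) \esum_(i in A) F i j)%E.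
Proof.
move=> F0; rewrite !esum_esum//.
rewrite (reindex_esum (A `*` B) _ (fun x => (x.2, x.1)))//; split=> //=.
- by move=> [i j] [/=].
- by move=> [i1 i2] [j1 j2] /= _ _ [] -> ->.
- by move=> [i1 i2] [Pi1 Qi2] /=; exists (i2, i1).
Qed.

Lemma esum_single (R : realType) (T : choiceType) (f : T -> \bar R) (x : T) :
  (0 <= f x)%E -> (forall y, y != x -> f y = 0%E) ->
  (\esum_(y in [set: T]) f y = f x)%E.
Proof.
move=> fx0 f0; rewrite -(esum_set1 fx0) [RHS]esum_mkcond; apply: eq_esum => y _.
have [->|yx] := eqVneq y x; first by rewrite mem_set.
by rewrite memNset ?f0// => /eqP; rewrite (negPf yx).
Qed.

Lemma rsum_single (R : realType) (T : choiceType) (f : T -> R) (x : T) :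
  (forall y, y != x -> f y = 0) -> rsum f = f x.
Proof.
move=> f0; rewrite /rsum.
rewrite (esum_single (f := fun y => (Num.max (f y) 0)%:E) (x := x)); last 2 first.
- by rewrite lee_fin le_max lexx orbT.
- by move=> y yx; rewrite f0// maxxx.
rewrite (esum_single (f := fun y => (Num.max (- f y) 0)%:E) (x := x)); last 2 first.
- by rewrite lee_fin le_max lexx orbT.
- by move=> y yx; rewrite f0// oppr0 maxxx.
rewrite /=.
have [h|h] := leP (f x) 0.
  by rewrite max_l ?oppr_ge0// sub0r opprK.
by rewrite max_r ?subr0// oppr_le0 ltW.
Qed.

(** * The vectors $\delta_x \otimes v$ and the orthonormal basis they yield *)

Section L2Basis.
Context (R : realType) (G : groupType) (V : vectType R[i])
  (dot : {dot V for conjC}).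
Implicit Types (u w : l2 G dot) (h : G -> 'End(V)) (x y : G) (v : V).

Definition delta_fun x v : G -> V := fun y => if y == x then v else 0.

Fact delta_sqsummable x v : delta_fun x v \in sqsummable dot.
Proof.
rewrite unfold_in; apply/asboolP; rewrite (esum_single (x := x)) ?ltry//.
  by rewrite lee_fin; exact: sqn_ge0.
by move=> y yx; rewrite /delta_fun (negPf yx) linear0l.
Qed.

Definition delta x v : l2 G dot := L2 (delta_sqsummable x v).

Lemma l2dot_deltal x v w : l2dot (delta x v) w = dot v (w x).
Proof.
rewrite /l2dot /csum; rewrite !(rsum_single (x := x)) /= /delta_fun ?eqxx.
- by case: (dot v (w x)).
- by move=> y yx; rewrite (negPf yx) linear0l.
- by move=> y yx; rewrite (negPf yx) linear0l.
Qed.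

Lemma l2dot_deltar x v w : l2dot w (delta x v) = dot (w x) v.
Proof. by rewrite [RHS]dotC -(l2dot_deltal x v w); exact: dotC. Qed.

Lemma rsummable_l2 u w : rsummable (fun x => complex.Re (dot (u x) (w x))).
Proof. by have [] := l2_csummable u w. Qed.

Lemma sqn_l2 u :
  (sqn (@l2dot R G V dot) u)%:E = (\esum_(x in [set: G]) (sqn dot (u x))%:E)%E.
Proof.
have u0 x : 0 <= sqn dot (u x) by exact: sqn_ge0.
rewrite [sqn _ _](rsum_ge0E u0) fineK//.
exact: fin_num_esum (rsummable_l2 u u) u0.
Qed.

Lemma l2P u w : (forall x, u x = w x) -> u = w.
Proof. by move=> uw; apply/val_inj/funext. Qed.

Lemma mult_op_val h u : dom (mult_op dot h) u ->
  (mult_op dot h u : G -> V) = (fun x => h x (u x)).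
Proof. by move=> hu; rewrite /= insubdK. Qed.

Lemma mult_op_delta_fun h x v :
  (fun y => h y (delta x v y)) = delta x (h x v).
Proof.
apply/funext => y; rewrite /= /delta_fun.
by have [->//|_] := eqVneq y x; rewrite linear0.
Qed.

Lemma dom_mult_op_delta h x v : dom (mult_op dot h) (delta x v).
Proof. by rewrite /= mult_op_delta_fun; exact: delta_sqsummable. Qed.

Lemma mult_op_delta h x v : mult_op dot h (delta x v) = delta x (h x v).
Proof.
apply/val_inj; rewrite [LHS](mult_op_val (dom_mult_op_delta h x v)).
exact: mult_op_delta_fun.
Qed.

(** Combined with the density of the span of [l2_basis], this makes [mult_op] densely defined. *)
Lemma dom_mult_op_comb h (s : seq (l2 G dot)) (a : l2 G dot -> R[i]) :
  (forall w, w \in s -> dom (mult_op dot h) w) ->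
  dom (mult_op dot h) (\sum_(w <- s) a w *: w).
Proof.
move=> hs; rewrite big_seq.
elim/big_ind : _ => [|u w hu hw|w /hs hw].
- rewrite /= (_ : (fun _ => _) = 0) ?rpred0//.
  by apply/funext => x; rewrite linear0.
- rewrite /= (_ : (fun _ => _) = (fun x => h x (u x)) + (fun x => h x (w x))).
    exact: rpredD.
  by apply/funext => x; rewrite /= linearD.
- rewrite /= (_ : (fun _ => _) = a w *: (fun x => h x (w x))).
    exact: rpredZ.
  by apply/funext => x; rewrite /= linearZ.
Qed.

Context (n : nat) (e : G -> 'I_n -> V).
Hypothesis oe : forall x i j, dot (e x i) (e x j) = (i == j)%:R.
Hypothesis ex : forall x v, v = \sum_i dot v (e x i) *: e x i.

Definition l2_basis : set (l2 G dot) :=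
  range (fun p : G * 'I_n => delta p.1 (e p.1 p.2)).

Lemma l2dot_basis x i y j :
  l2dot (delta x (e x i)) (delta y (e y j)) = ((x, i) == (y, j))%:R.
Proof.
rewrite l2dot_deltal /= /delta_fun xpair_eqE.
by have [->|_] := eqVneq x y; rewrite ?oe// linear0r.
Qed.

Lemma l2_basis_inj : injective (fun p : G * 'I_n => delta p.1 (e p.1 p.2)).
Proof.
move=> [x i] [y j] /= E; apply/eqP; apply: contraTT isT => /negPf ne.
have := l2dot_basis x i y j; rewrite ne E l2dot_basis eqxx => /eqP.
by rewrite oner_eq0.
Qed.

Lemma sqn_coord x v : sqn dot v = \sum_i nsq (dot v (e x i)).
Proof.
rewrite {1}/sqn {1}(ex x v) linear_sumlz raddf_sum; apply: eq_bigr => i _ /=.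
by rewrite dotZl [dot (e x i) v]dotC.
Qed.

Lemma l2_basis_orthonormal : orthonormal_set (@l2dot R G V dot) l2_basis.
Proof.
move=> _ _ /set_mem[[x i] _ <-] /set_mem[[y j] _ <-] /=.
by rewrite l2dot_basis -(inj_eq l2_basis_inj).
Qed.

(** For density, a finite set [A] of group elements carries all but $\varepsilon^2$ of the squared
    norm of [u]. The projection of [u] onto the basis vectors over [A] has as squared error exactly
    the part of the norm outside [A]. *)
Lemma l2_basis_orthonormal_basis : orthonormal_basis (@l2dot R G V dot) l2_basis.
Proof.
split; first exact: l2_basis_orthonormal.
move=> u eps eps0.
have : ((sqn (@l2dot R G V dot) u - eps ^+ 2)%:E <
    \esum_(x in [set: G]) (sqn dot (u x))%:E)%E.
  by rewrite -sqn_l2 lte_fin ltrBlDr ltrDl exprn_gt0.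
move=> /ereal_sup_gt[_ [A [fA _] <-]].
rewrite fsbig_finite// sumEFin lte_fin => hA.
pose s : seq (l2 G dot) := [seq delta x (e x i) | x <- fset_set A, i <- enum 'I_n].
have sE (F : l2 G dot -> R) : \sum_(w <- s) F w =
    \sum_(x <- fset_set A) \sum_i F (delta x (e x i)).
  by rewrite big_allpairs_dep; apply: eq_bigr => x _; rewrite big_enum.
have us : uniq s.
  rewrite allpairs_uniq ?enum_uniq ?fset_uniq//.
  by move=> [x i] [y j] _ _; exact: (@l2_basis_inj (x, i) (y, j)).
have sB : {subset s <= l2_basis}.
  by move=> _ /allpairsP[[x i] /= [_ _ ->]]; apply/mem_set; exists (x, i).
exists (\sum_(w <- s) l2dot u w *: w); first by exists s, (l2dot u).
rewrite norm_of_sqn -(gtr0_norm eps0) -sqrtr_sqr ltr_sqrt ?exprn_gt0//.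
rewrite (sqn_sub_comb _ _ l2_basis_orthonormal)// [X in _ + X]big1 ?addr0; last first.
  by move=> w _; rewrite subrr nsq0.
rewrite sE (eq_bigr (fun x => sqn dot (u x))); first by rewrite ltrBlDr addrC -ltrBlDr.
move=> x _; rewrite (sqn_coord x); apply: eq_bigr => i _.
by congr nsq; exact/l2dot_deltar.
Qed.

End L2Basis.

Lemma dot_inj (R : realType) (V : lmodType R[i]) (dot : {dot V for conjC}) (a b : V) :
  (forall v, dot v a = dot v b) -> a = b.
Proof.
move=> ab; apply/eqP; rewrite -subr_eq0 -(dnorm_eq0 dot).
by have := ab (a - b); rewrite linearBr /= => ->; rewrite subrr.
Qed.

(** * Functional calculus and trace for multiplication operators *)

Section MultOp.
Context (R : realType) (G : groupType) (V : vectType R[i])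
  (dot : {dot V for conjC}) (ell : G -> 'End(V)).
Context (n : nat) (e : G -> 'I_n -> V) (l : G -> 'I_n -> R).
Hypothesis el : forall x, eigenbasis dot (ell x) (e x) (l x).
Implicit Types (h : G -> 'End(V)) (u w : l2 G dot) (f : R -> R).

Local Notation l2d := (@l2dot R G V dot).

Let oe x i j : dot (e x i) (e x j) = (i == j)%:R.
Proof. by case: (el x). Qed.

Let ex x v : v = \sum_i dot v (e x i) *: e x i.
Proof. by case: (el x). Qed.

(** If [(u, v)] lies in the graph of the adjoint, testing against [delta x w] gives
    [h x (u x) = v x] for every [x]; as [v] is square summable, [u] belongs to the domain. *)
Lemma self_adjoint_mult_op h : (forall x, self_adjoint_end dot (h x)) ->
  self_adjoint l2d (mult_op dot h).
Proof.
move=> sh; split.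
  move=> u eps /((l2_basis_orthonormal_basis oe ex).2 u)[_ [s [a [sB ->]]] us].
  exists (\sum_(w <- s) a w *: w) => //.
  apply: dom_mult_op_comb => w /sB /set_mem [[x i] _ <-].
  exact: dom_mult_op_delta.
move=> u v; split=> [[hu <-] w hw|hw].
  congr csum; apply/funext => x.
  by rewrite (mult_op_val hw) (mult_op_val hu) sh.
have huv : (fun x => h x (u x)) = v.
  apply/funext => x; apply: (@dot_inj _ _ dot) => w; rewrite -sh.
  have := hw (delta dot x w) (dom_mult_op_delta dot h x w).
  by rewrite mult_op_delta => E; rewrite -2!l2dot_deltal.
have hu : dom (mult_op dot h) u by rewrite /= huv; exact: valP.
by split=> //; apply/val_inj; rewrite [LHS](mult_op_val hu).
Qed.

Lemma one_plus_square_delta x i :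
  dom (one_plus_square (mult_op dot ell)) (delta dot x (e x i)) /\
  one_plus_square (mult_op dot ell) (delta dot x (e x i)) =
    (1 + l x i ^+ 2)%:C *: delta dot x (e x i).
Proof.
split.
  split; first exact: dom_mult_op_delta.
  by rewrite mult_op_delta; exact: dom_mult_op_delta.
rewrite -[LHS]/(_ + mult_op dot ell (mult_op dot ell _)) !mult_op_delta; apply: l2P => y.
rewrite /= /delta_fun !fctE; have [_|_] := eqVneq y x; last by rewrite addr0 scaler0.
case: (el x) => _ ae _; rewrite ae linearZ /= ae scalerA -rmorphM /= -expr2.
by rewrite rmorphD scalerDl scale1r.
Qed.

(** In the coordinates of an [r]-eigenvector the equation reads $(1 + l_{x,i}^2) c = r c$. So each
    coordinate either vanishes or has $1 + l_{x,i}^2 = r$, and the diagonal operator multiplies it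
    by $f(r)$ in both cases. *)
Lemma is_fun_mult_op f : Defs.is_fun l2d f (one_plus_square (mult_op dot ell))
  (mult_op dot (fun x => diag_end dot (e x) (fun i => f (1 + l x i ^+ 2)))).
Proof.
split; first by apply: self_adjoint_mult_op => x; exact: diag_end_self_adjoint.
move=> r u [hu hu2] Au.
have E x : diag_end dot (e x) (fun i => f (1 + l x i ^+ 2)) (u x) = (f r)%:C *: u x.
  rewrite diag_endE [in RHS](ex x (u x)) scaler_sumr; apply: eq_bigr => i _.
  rewrite scalerA; congr (_ *: _).
  have [->|ui] := eqVneq (dot (u x) (e x i)) 0; first by rewrite !mulr0.
  have := congr1 (fun w : l2 G dot => dot (w x) (e x i)) Au.
  rewrite -[one_plus_square _ _]/(u + mult_op dot ell (mult_op dot ell u)).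
  rewrite -[(_ + _ : l2 G dot) x]/(u x + mult_op dot ell (mult_op dot ell u) x).
  rewrite (mult_op_val hu2) (mult_op_val hu) linearDl /=.
  rewrite !(eigenbasis_coord (el x)) dotZl mulrA.
  rewrite -[X in X + _]mul1r -mulrDl => /(mulIf ui).
  by rewrite -rmorphM -[1]/(1%:C) -rmorphD /= -expr2 => /complexI ->.
have hT : dom (mult_op dot (fun x => diag_end dot (e x)
    (fun i => f (1 + l x i ^+ 2)))) u.
  rewrite /= (_ : (fun _ => _) = (f r)%:C *: (u : G -> V)).
    by rewrite rpredZ//; exact: valP.
  by apply/funext => x; rewrite E.
split=> //; apply/val_inj; rewrite [LHS](mult_op_val hT).
by apply/funext => x; rewrite E.
Qed.

(* For u in the domain of T, symmetry of T against the eigenvectors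
   delta_x (x) e_{x,i} already forces (T u) x = f(1 + ell(x)^2) (u x), so
   uniqueness of f(A) is never needed. *)
Lemma trace_is_fun f (T : operator (l2 G dot)) :
  (forall x i, 0 <= f (1 + l x i ^+ 2)) ->
  Defs.is_fun l2d f (one_plus_square (mult_op dot ell)) T ->
  (trace l2d T =
   \esum_(x in [set: G]) (\sum_i f (1 + l x i ^+ 2))%:E)%E.
Proof.
move=> f0 [[_ saT] fT].
pose mu x i := f (1 + l x i ^+ 2).
have Tdelta x i : dom T (delta dot x (e x i)) /\
    T (delta dot x (e x i)) = (mu x i)%:C *: delta dot x (e x i).
  by have [d1 d2] := one_plus_square_delta x i; exact: fT d1 d2.
(* [l2_basis e] only shows that a suitable basis exists; [xget] may return any other, so the trace
   is computed for an arbitrary [B] in the domain. *)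
rewrite /trace; set B := xget _ _.
have [oB BT] : orthonormal_basis l2d B /\ B `<=` dom T.
  rewrite /B; case: xgetP => [? _ //|] /(_ (l2_basis e)) [].
  split; first exact: (l2_basis_orthonormal_basis oe ex).
  by move=> _ [[x i] _ <-]; case: (Tdelta x i).
have TE u x : dom T u -> T u x = diag_end dot (e x) (mu x) (u x).
  move=> hu; rewrite diag_endE [LHS](ex x (T u x)); apply: eq_bigr => i _.
  congr (_ *: _); have [d1 d2] := Tdelta x i.
  have E : dot (e x i) (T u x) = (mu x i)%:C * dot (e x i) (u x).
    rewrite -!l2dot_deltal -((saT u (T u)).1 (conj hu erefl) _ d1) d2.
    exact: dotZl.
  by rewrite dotC E rmorphM /= conjC_real -dotC.
have TuE u : B u -> (complex.Re (l2d (T u) u))%:E =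
    (\esum_(x in [set: G]) (\sum_i mu x i * nsq (dot (u x) (e x i)))%:E)%E.
  move=> /BT hu.
  have F0 x : 0 <= complex.Re (dot (T u x) (u x)).
    rewrite TE// Re_dot_diag_end sumr_ge0// => i _.
    by rewrite mulr_ge0 ?nsq_ge0 ?f0.
  rewrite [complex.Re _](rsum_ge0E F0) fineK; last first.
    exact: fin_num_esum (rsummable_l2 (T u) u) F0.
  by apply: eq_esum => x _; rewrite TE// Re_dot_diag_end.
rewrite (eq_esum TuE) esum_swap; last first.
  move=> u x; rewrite lee_fin sumr_ge0// => i _.
  by rewrite mulr_ge0 ?nsq_ge0 ?f0.
apply: eq_esum => x _.
under eq_esum do rewrite -sumEFin.
rewrite esum_sum; last by move=> u i _ _; rewrite lee_fin mulr_ge0 ?nsq_ge0 ?f0.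
rewrite -sumEFin; apply: eq_bigr => i _.
(* The weight [mu x i] is absorbed into the vector: Parseval for [B], applied to
   [c *: delta dot x (e x i)], sums the weighted squared coefficients to the squared norm
   [mu x i]. *)
pose c := (Num.sqrt (mu x i))%:C.
have cc (z : R[i]) : nsq (c * z) = mu x i * nsq z.
  rewrite {1}/nsq rmorphM /= mulrACA (mul_conj_nsq z) conjC_real -!rmorphM /=.
  by rewrite -expr2 sqr_sqrtr ?f0.
have sq1 : sqn l2d (c *: delta dot x (e x i)) = mu x i.
  apply: complexI; rewrite -dot_sqn dotZl dotZr.
  rewrite [X in _ * (_ * X)](l2dot_deltal x (e x i) _) /= /delta_fun eqxx.
  by rewrite oe eqxx mulr1 conjC_real -rmorphM -expr2 sqr_sqrtr ?f0.
rewrite -[RHS]/(mu x i)%:E -[in RHS]sq1 -(parseval _ oB).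
apply: eq_esum => u _; congr EFin.
rewrite dotZl cc [in LHS]dotC nsq_conj; congr (_ * nsq _).
exact/esym/l2dot_deltal.
Qed.

(** [op_power] is an [xget] choice as well: [is_fun_mult_op] shows that a candidate exists, and
    [trace_is_fun] gives the trace of whichever one is chosen. *)
Lemma zeta_group_triple (t : R) : zeta (group_triple dot ell) t =
  (\esum_(x in [set: G]) (\sum_i (1 + l x i ^+ 2) `^ (- t / 2))%:E)%E.
Proof.
have isf : Defs.is_fun l2d (fun r => r `^ (- t / 2))
    (one_plus_square (mult_op dot ell))
    (op_power l2d (one_plus_square (mult_op dot ell)) (- t / 2)).
  rewrite /op_power; case: xgetP => [T _ //|].
  by move=> /(_ _ (is_fun_mult_op (fun r => r `^ (- t / 2)))).
by rewrite -(trace_is_fun _ isf)// => x i; exact: powR_ge0.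
Qed.

End MultOp.

(** * The logarithmic growth exponent and power bounds on a counting sequence *)

Section LogGrowth.
Context (R : realType) (c : nat -> nat).
Hypothesis c_gt0 : forall k, (0 < c k)%N.

Local Notation lgrowth := (limn_esup (fun k => (ln (c k)%:R / ln (k%:R : R))%:E)).

Lemma limn_esup_ln_ge0 : (0 <= lgrowth)%E.
Proof.
apply: limf_esup_ge0 => [|k].
  by move=> [N _ /(_ N)]; apply => /=.
rewrite lee_fin divr_ge0//.
  by rewrite ln_ge0// ler1n.
(* At [k = 0] the convention that [ln] is 0 at 0 applies. *)
by case: k => [|k]; [rewrite ln0|rewrite ln_ge0// ler1n].
Qed.

(** Taking logarithms bounds the quotient by $s + \ln C / \ln k$, and the last term is at most
    $\varepsilon$ as soon as $k \ge \exp(|\ln C| / \varepsilon)$. *)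
Lemma limn_esup_ln_le (C s : R) : 0 < C ->
  (\forall k \near \oo, (c k)%:R <= C * k%:R `^ s) -> (lgrowth <= s%:E)%E.
Proof.
move=> C0 [N _ hN]; apply/lee_addgt0Pr => eps eps0.
have [M hM] : exists M : nat, forall k, (M <= k)%N -> expR (`|ln C| / eps) <= k%:R.
  exists (Num.bound (expR (`|ln C| / eps))) => k Mk.
  apply: (@le_trans _ _ (Num.bound (expR (`|ln C| / eps)))%:R).
    by rewrite ltW// archi_boundP ?expR_ge0.
  by rewrite ler_nat.
(* The 2 ensures [ln k > 0], so that the quotient can be cleared. *)
pose K := maxn N (maxn M 2).
apply: (@le_trans _ _ (ereal_sup
    ((fun k => (ln (c k)%:R / ln (k%:R : R))%:E) @` [set k | (K <= k)%N]))).
  apply: ereal_inf_lbound; exists [set k | (K <= k)%N] => //.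
  by exists K.
apply: ge_ereal_sup => _ [k /= + <-].
rewrite !geq_max => /and3P[Nk Mk k2].
have k0 : 0 < (k%:R : R) by rewrite ltr0n (leq_trans _ k2).
have lnk : 0 < ln (k%:R : R) by rewrite ln_gt0// ltr1n.
rewrite -EFinD lee_fin ler_pdivrMr// mulrDl.
have : ln (c k)%:R <= ln (C * k%:R `^ s).
  rewrite ler_ln ?posrE ?mulr_gt0 ?powR_gt0 ?ltr0n ?(leq_trans _ k2)//.
  exact: hN.
rewrite lnM ?posrE ?powR_gt0// ln_powR => h.
have : ln C <= eps * ln k%:R.
  rewrite mulrC -ler_pdivrMr//; apply: (@le_trans _ _ (`|ln C| / eps)).
    by rewrite ler_pM2r ?invr_gt0// ler_norm.
  by rewrite -[leLHS]expRK ler_ln ?posrE ?expR_gt0//; exact: hM.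
by move: h; lra.
Qed.

(** Beyond some [K] the bound holds with constant 1. For smaller [k] monotonicity gives
    [c k <= c K], and $k^s \ge 1$, so [c K] serves as the constant throughout. *)
Lemma limn_esup_ln_lt (s : R) : 0 <= s -> {homo c : i j / (i <= j)%N} ->
  (lgrowth < s%:E)%E ->
  exists2 C : R, 0 < C & forall k, (0 < k)%N -> (c k)%:R <= C * k%:R `^ s.
Proof.
move=> s0 cmono /ereal_inf_lt[_ [A [N _ NA] <-] hA].
pose K := maxn N 2.
exists (c K)%:R => [|k k0]; first by rewrite ltr0n.
have k1 : 1 <= (k%:R : R) by rewrite ler1n.
have ks : 1 <= (k%:R : R) `^ s by have := ler_powR k1 s0; rewrite powRr0.
have [kK|/ltnW Kk] := leqP k K.
  apply: (@le_trans _ _ (c K)%:R); first by rewrite ler_nat cmono.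
  by rewrite ler_peMr// ler0n.
move: Kk; rewrite geq_max => /andP[Nk k2].
have lnk : 0 < ln (k%:R : R) by rewrite ln_gt0// ltr1n.
apply: (@le_trans _ _ (k%:R `^ s)); last first.
  by rewrite ler_peMl ?powR_ge0// ler1n.
have : ((ln (c k)%:R / ln (k%:R : R))%:E < s%:E)%E.
  by apply: le_lt_trans hA; apply: ereal_sup_ubound; exists k => //; exact: NA.
rewrite lte_fin ltr_pdivrMr// -ln_powR => /ltW.
by rewrite ler_ln ?posrE ?powR_gt0 ?ltr0n.
Qed.

End LogGrowth.

(** * Comparison of the eigenvalue sum with the counting function of the balls *)

Section CountingFunction.
Context (R : realType) (T : choiceType) (n : nat) (l : T -> 'I_n -> R).

Definition count_ball (k : nat) : set T := [set x | exists i, `|l x i| <= k%:R].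
Definition count_card (k : nat) : nat := #|` fset_set (count_ball k)|.
Definition zeta_sum (t : R) : \bar R :=
  \esum_(x in [set: T]) (\sum_i (1 + l x i ^+ 2) `^ (- t / 2))%:E.

Hypothesis fin_ball : forall k, finite_set (count_ball k).

Lemma count_card_homo : {homo count_card : i j / (i <= j)%N}.
Proof.
move=> i j ij; apply: fsubset_leq_card; rewrite -fset_set_sub//.
by move=> x [k /le_trans h]; exists k; apply: h; rewrite ler_nat.
Qed.

Lemma zeta_sum_nonincreasing (s t : R) : s <= t -> (zeta_sum t <= zeta_sum s)%E.
Proof.
move=> st; apply: le_esum => x _; rewrite lee_fin ler_sum// => i _.
by rewrite ler_powR ?lerDl ?sqr_ge0// ler_pM2r// lerN2.
Qed.

Lemma count_card_le (t : R) : 0 < t -> (zeta_sum t < +oo)%E ->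
  exists2 C : R, 0 < C & forall k, (0 < k)%N ->
    (count_card k)%:R <= C * k%:R `^ t.
Proof.
move=> t0 zt.
have Fx0 x : 0 <= \sum_i (1 + l x i ^+ 2) `^ (- t / 2).
  by apply: sumr_ge0 => i _; exact: powR_ge0.
have z0 : (0 <= zeta_sum t)%E by apply: esum_ge0 => x _; rewrite lee_fin.
have zf : zeta_sum t = (fine (zeta_sum t))%:E by rewrite fineK// ge0_fin_numE.
(* The factor $2^{t/2}$ comes from $1 + k^2 \le 2 k^2$ for $k \ge 1$; adding 1 keeps the constant
   positive. *)
exists ((fine (zeta_sum t) + 1) * 2 `^ (t / 2)) => [|k k0].
  by rewrite mulr_gt0 ?powR_gt0// ltr_wpDl// fine_ge0.
have k1 : 1 <= (k%:R : R) by rewrite ler1n.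
pose m : R := 1 + k%:R ^+ 2.
have m0 : 0 < m by rewrite ltr_wpDr ?sqr_ge0.
have H : (count_card k)%:R * m `^ (- t / 2) <= fine (zeta_sum t).
  rewrite -lee_fin -zf; apply: esum_ge; exists (count_ball k); first by split.
  rewrite fsbig_finite// sumEFin lee_fin.
  apply: (@le_trans _ _ (\sum_(x <- fset_set (count_ball k)) m `^ (- t / 2))).
    by rewrite big_const_seq count_predT iter_addr addr0 mulr_natl.
  rewrite big_seq [leRHS]big_seq; apply: ler_sum => x.
  rewrite in_fset_set// inE => -[i xi].
  rewrite (bigD1 i)//= -[leLHS]addr0 lerD ?sumr_ge0//; last first.
    by move=> j _; exact: powR_ge0.
  rewrite mulNr !powRN lef_pV2 ?posrE ?powR_gt0 ?ltr_wpDr ?sqr_ge0//.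
  have lm : 1 + l x i ^+ 2 <= m.
    by rewrite lerD2l -real_normK ?num_real// lerXn2r ?nnegrE.
  by rewrite ge0_ler_powR ?nnegrE ?addr_ge0 ?sqr_ge0 ?divr_ge0// ltW.
have {}H : (count_card k)%:R <= fine (zeta_sum t) * m `^ (t / 2).
  by rewrite mulNr powRN ler_pdivrMr ?powR_gt0// in H.
have kt : k%:R `^ t = (k%:R ^+ 2) `^ (t / 2).
  by rewrite -powR_mulrn// -powRrM mulrC divfK.
apply: (le_trans H); rewrite -mulrA kt -powRM ?sqr_ge0//.
rewrite ler_pM ?fine_ge0 ?powR_ge0 ?lerDl//.
have mk : m <= 2 * k%:R ^+ 2 by rewrite mulr_natl mulr2n lerD2r expr_ge1.
rewrite ge0_ler_powR ?nnegrE ?mulr_ge0 ?sqr_ge0 ?divr_ge0//; exact: ltW.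
Qed.

(** With the least [j] such that $|a| \le 2^j$, one has $(2^j/2)^2 \le 1 + a^2$: for $j > 0$
    minimality gives $2^{j-1} < |a|$, and for $j = 0$ the left side is $1/4$. *)
Lemma dyadic_powR (a t : R) : 0 <= t ->
  exists2 j : nat, `|a| <= 2 ^+ j & (1 + a ^+ 2) `^ (- t / 2) <= (2 ^+ j / 2) `^ (- t).
Proof.
move=> t0.
have ex : exists j : nat, `|a| <= 2 ^+ j.
  exists (Num.bound `|a|); apply: (@le_trans _ _ (Num.bound `|a|)%:R).
    by rewrite ltW// archi_boundP.
  by rewrite -natrX ler_nat ltnW// ltn_expl.
exists (ex_minn ex); case: ex_minnP => j aj jmin //.
have j0 : 0 < (2 ^+ j / 2 : R) by rewrite divr_gt0 ?exprn_gt0.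
have {aj jmin} aj : (2 ^+ j / 2) ^+ 2 <= 1 + a ^+ 2.
  case: j {aj} jmin j0 => [|j] jmin j0.
    apply: (@le_trans _ _ 1); last by rewrite lerDl sqr_ge0.
    by rewrite expr0 mul1r exprn_ile1// ?invr_ge0// invf_le1// ler1n.
  rewrite [2 ^+ j.+1]exprS mulrAC divff// mul1r -[a ^+ 2]real_normK ?num_real//.
  apply: ler_wpDl => //; rewrite lerXn2r ?nnegrE ?exprn_ge0//.
  by rewrite leNgt; apply/negP => /ltW/jmin; rewrite ltnn.
have -> : (2 ^+ j / 2 : R) `^ (- t) = ((2 ^+ j / 2) ^+ 2) `^ (- t / 2).
  by rewrite -(powR_mulrn 2 (ltW j0)) -powRrM; congr (_ `^ _); rewrite mulrC divfK.
rewrite mulNr !powRN lef_pV2 ?posrE ?powR_gt0 ?exprn_gt0 ?ltr_wpDr ?sqr_ge0//.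
by rewrite ge0_ler_powR ?nnegrE ?addr_ge0 ?sqr_ge0 ?divr_ge0.
Qed.

Lemma esum_geometric_lty (a r : R) : 0 <= a -> 0 < r -> r < 1 ->
  (\esum_(j in [set: nat]) (a * r ^+ j)%:E < +oo)%E.
Proof.
move=> a0 r0 r1; rewrite -nneseries_esumT; last first.
  by move=> j; rewrite lee_fin mulr_ge0 ?exprn_ge0 ?(ltW r0).
apply: (@le_lt_trans _ _ (a / (1 - r))%:E); last exact: ltry.
apply: lime_le.
  by apply: is_cvg_nneseries => j _ _; rewrite lee_fin mulr_ge0 ?exprn_ge0 ?(ltW r0).
near=> m; rewrite sumEFin lee_fin.
by apply: geometric_le_lim; rewrite // gtr0_norm.
Unshelve. all: by end_near. Qed.

Lemma zeta_sum_lty (C s t : R) : 0 < C -> 0 <= s -> s < t ->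
  (forall k, (0 < k)%N -> (count_card k)%:R <= C * k%:R `^ s) ->
  (zeta_sum t < +oo)%E.
Proof.
move=> C0 s0 st hC; have t0 := le_lt_trans s0 st.
pose q j : R := (2 ^+ j / 2) `^ (- t).
(* For fixed [i], the term at [x] is bounded by the single [F x j] that [dyadic_powR] selects.
   Summing over all [j] overcounts, but lets the two sums be interchanged. *)
pose F x j : \bar R := if x \in count_ball (2 ^ j) then (q j)%:E else 0%E.
have F0 x j : (0 <= F x j)%E.
  by rewrite /F; case: ifP => // _; rewrite lee_fin powR_ge0.
(* The sum over [x] equals the cardinality of the ball of radius $2^j$ times [q j]; the factor $2^t$
   comes from the halving in [q]. *)
have EF j : (\esum_(x in [set: T]) F x j <= (C * 2 `^ t * (2 `^ (s - t)) ^+ j)%:E)%E.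
  rewrite -esum_mkcond esum_fset//; last by move=> x _; rewrite lee_fin powR_ge0.
  rewrite fsbig_finite// sumEFin lee_fin big_const_seq count_predT iter_addr addr0.
  rewrite -[leLHS]mulr_natl; apply: (@le_trans _ _ (C * (2 ^+ j) `^ s * q j)).
    by rewrite ler_wpM2r ?powR_ge0// -natrX hC// expn_gt0.
  rewrite /q powRM ?exprn_ge0 ?invr_ge0// -!mulrA ler_pM2l// mulrA.
  rewrite -powRD; last by apply/implyP => _; rewrite gt_eqF ?exprn_gt0.
  rewrite -[2^-1]powR_inv1// -powRrM mulN1r opprK mulrC ler_pM2l ?powR_gt0//.
  by rewrite -!powR_mulrn ?powR_ge0// -!powRrM mulrC.
rewrite /zeta_sum; under eq_esum do rewrite -sumEFin.
rewrite esum_sum; last by move=> x i _ _; rewrite lee_fin powR_ge0.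
apply: lte_sum_pinfty => i _.
apply: (@le_lt_trans _ _ (\esum_(x in [set: T]) \esum_(j in [set: nat]) F x j)%E).
  apply: le_esum => x _; have [j xj hj] := dyadic_powR (l x i) (ltW t0).
  apply: esum_ge; exists [set j]; first by split.
  rewrite fsbig_set1 /F mem_set ?lee_fin//.
  by exists i; rewrite natrX.
rewrite esum_swap//; apply: (@le_lt_trans _ _
    (\esum_(j in [set: nat]) (C * 2 `^ t * (2 `^ (s - t)) ^+ j)%:E)%E).
  by apply: le_esum => j _; exact: EF.
apply: esum_geometric_lty; rewrite ?mulr_ge0 ?powR_ge0 ?(ltW C0) ?powR_gt0//.
rewrite /powR gt_eqF// expR_lt1 nmulr_rlt0 ?subr_lt0//.
by rewrite ln_gt0// ltr1n.
Qed.

End CountingFunction.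

Theorem proposition3p5 (R : realType) (G : groupType) (V : vectType R[i])
    (dot : {dot V for (@Num.conj R[i])}%R) (ell : G -> 'End(V))
    (V_neq0 : (0 < \dim {:V})%N)
    (ell_sa : forall x : G, self_adjoint_end dot (ell x))
    (ell_bounded : translation_bounded dot ell)
    (ell_proper : proper_fun ell) :
  (finitely_summable (group_triple dot ell) <-> polynomial_growth dot ell) /\
  (finitely_summable (group_triple dot ell) ->
     abscissa (group_triple dot ell) = growth dot ell).
Proof.
have [e /choice[l el]] := choice (fun x => exists_eigenbasis (ell_sa x)).
have ballE k : growth_ball dot ell k = count_ball l k.
  by apply/seteqP; split => x /(inf_Sp_abs_end_le (el x) k%:R V_neq0).
have cardE k : growth_card dot ell k = count_card l k.
  by rewrite /growth_card ballE.
have growthE : growth dot ell =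
    limn_esup (fun k => (ln (count_card l k)%:R / ln (k%:R : R))%:E).
  by rewrite /growth; congr limn_esup; apply/funext => k; rewrite cardE.
have zetaE t : zeta (group_triple dot ell) t = zeta_sum l t.
  exact: zeta_group_triple el t.
case: ell_proper => ell0 disc fin.
(* Each [x] in the ball has an eigenvalue in $[-k, k]$. By properness only finitely many spectral
   values lie there, each attained at finitely many [x]. *)
have fin_ball k : finite_set (count_ball l k).
  apply: (@sub_finite_set _ _ (\bigcup_(t in spectrum_union ell `&` `[- k%:R, k%:R])
      [set x | Sp (ell x) t])); last first.
    by apply: bigcup_finite => [|t [St _]]; [exact: disc|exact: fin].
  move=> x [i xi]; exists (l x i); last first.
    by rewrite /= (Sp_eigenbasis (el x)); exists i.
  split; first by exists x => //; rewrite (Sp_eigenbasis (el x)); exists i.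
  by rewrite /= in_itv /= -ler_norml.
(* Since [ell 1 = 0], the neutral element lies in every ball, so logarithms of the counts are taken
   at positive integers. *)
have card_gt0 k : (0 < count_card l k)%N.
  rewrite cardfs_gt0; apply/fset0Pn; exists 1%g.
  rewrite in_fset_set// inE; exists (Ordinal V_neq0).
  have [_ ae _] := el 1%g; have := ae (Ordinal V_neq0).
  have /ell0-> : 1%g = 1%g :> G by [].
  rewrite lfunE /= => /esym/eqP; rewrite scaler_eq0.
  rewrite (negPf (eigenbasis_neq0 (el 1%g) _)) orbF.
  by move=> /eqP/complexI ->; rewrite normr0.
(* [finitely_summable] allows any real exponent; as the sum is nonincreasing in it, passing to the
   maximum with 1 yields a positive one. *)
have fs_pos : finitely_summable (group_triple dot ell) ->
    exists2 t, 0 < t & (zeta_sum l t < +oo)%E.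
  move=> [t]; rewrite zetaE => zt; exists (Num.max t 1).
    by rewrite lt_max ltr01 orbT.
  by apply: le_lt_trans zt; apply: zeta_sum_nonincreasing; rewrite le_max lexx.
have growth_le t : 0 < t -> (zeta_sum l t < +oo)%E -> (growth dot ell <= t%:E)%E.
  move=> t0 /(count_card_le fin_ball t0)[C C0 hC].
  rewrite growthE; apply: (limn_esup_ln_le card_gt0 C0).
  by exists 1%N => // k /= k0; exact: hC.
(* The gap between the growth and [s] turns the limsup into a bound by $C k^s$; the gap between [s]
   and [t] makes the geometric series converge. *)
have zeta_lty (s t : R) : 0 <= s -> s < t -> (growth dot ell < s%:E)%E ->
    (zeta_sum l t < +oo)%E.
  rewrite growthE => s0 st.
  move=> /(limn_esup_ln_lt card_gt0 s0 (count_card_homo fin_ball))[C C0 hC].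
  exact: zeta_sum_lty C0 s0 st hC.
have growth_ge0 : (0 <= growth dot ell)%E by rewrite growthE; exact: limn_esup_ln_ge0.
split; first split.
- move=> /fs_pos[t t0 /(count_card_le fin_ball t0)[C C0 hC]].
  exists C, (Num.bound t); exists 1%N => // k /= k0.
  rewrite cardE; apply: (le_trans (hC k k0)).
  rewrite ler_pM2l// -powR_mulrn// ler_powR ?ler1n//.
  by rewrite ltW// archi_boundP// ltW.
(* The growth is at most [m], and the exponents [m + 1] and [m + 2] provide the two strict gaps.
   Since [c] may be nonpositive, it is replaced by [|c| + 1]. *)
- move=> [c [m [N _ hN]]]; exists (m%:R + 2); rewrite zetaE.
  apply: (zeta_lty (m%:R + 1)); rewrite ?addr_ge0 ?ltrD2l ?ltr1n//.
  apply: (@le_lt_trans _ _ m%:R%:E); last by rewrite lte_fin ltrDl.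
  rewrite growthE; apply: (@limn_esup_ln_le _ _ card_gt0 (`|c| + 1)).
    by rewrite ltr_wpDl.
  exists N => // k /hN /=; rewrite cardE powR_mulrn// => /le_trans; apply.
  by rewrite ler_wpM2r ?exprn_ge0// (le_trans (ler_norm c))// lerDl.
- move=> /fs_pos[t0 t0_gt0 zt0].
  have gf : growth dot ell = (fine (growth dot ell))%:E.
    rewrite fineK// ge0_fin_numE//.
    by apply: le_lt_trans (growth_le _ t0_gt0 zt0) _; exact: ltry.
  (* The growth is a lower bound of the exponents of convergence by [growth_le]. Conversely every
     growth $+\,\varepsilon$ is such an exponent, with growth $+\,\varepsilon/2$ as the intermediate
     value. *)
  apply/eqP; rewrite eq_le; apply/andP; split; last first.
    apply: le_ereal_inf_tmp => _ [t [t_gt0 zt] <-].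
    by apply: growth_le => //; rewrite -zetaE.
  apply/lee_addgt0Pr => eps eps0; rewrite gf -EFinD.
  have g0 : 0 <= fine (growth dot ell) by exact: fine_ge0.
  apply: ereal_inf_lbound; exists (fine (growth dot ell) + eps) => //.
  split; first by rewrite ltr_wpDl.
  rewrite zetaE; apply: (zeta_lty (fine (growth dot ell) + eps / 2)).
  + by rewrite addr_ge0// divr_ge0// ltW.
  + by rewrite ltrD2l ltr_pdivrMr// ltr_pMr// ltr1n.
  + by rewrite [X in (X < _)%E]gf lte_fin ltrDl divr_gt0.
Qed.
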